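(* Let $(x_n)_{n\ge 0}$ be the sequence of rational numbers defined by $x_0=1$ and $x_{n+1}=1+\frac{n}{x_n}$ for all integers $n\ge 0$. Then, for an integer $n\geq 0$, $x_n$ is an integer if and only if $n\in\{0,1,2,3\}$.
   Context: All terms $x_n$ are positive, so the recurrence is well defined. *)

(* Defs.v *)
From mathcomp Require Export all_boot all_order all_algebra.

(* Main.v *)
Require Import Defs.
From mathcomp Require Import all_boot all_order all_algebra.
From mathcomp Require Import ring lra zify.
Import GRing.Theory Num.Theory.
Local Open Scope ring_scope.

(** The positive fixed point of [y |-> 1 + n / y] is the positive root of
    [y * (y - 1) = n], so [x n] should follow that root up to a shift of [n] by
    less than one.  Indeed for [n >= 4] the number [x n * (x n - 1)] lies
    strictly between the consecutive integers [n - 1] and [n]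
    ([pronic_trapped]).  It is therefore not an integer, and neither is [x n].
    The trapping propagates by itself under the recurrence ([pronic_trap_step])
    and starts at [x 4 = 5/2], where [3 < 15/4 < 4]. *)

(** With [y = 1 + a / x] one has [y * (y - 1) = a * (x + a) / x ^+ 2].  The lower
    bound on [y] is thus the upper bound on [x], and the upper bound follows
    from the lower one on [x] because
    [(a + 1) * (x + a - 1) = a * (x + a) + (x - 1)]. *)
Lemma pronic_trap_step (F : realFieldType) (a x y : F) :
    0 < a -> 1 < x -> a - 1 < x * (x - 1) < a -> y = 1 + a / x ->
  a < y * (y - 1) < a + 1.
Proof.
move=> a_gt0 x_gt1 /andP[lo hi] y_def.
have x_gt0 : 0 < x by lra.
have -> : y * (y - 1) = a * (x + a) / x ^+ 2.
  by rewrite y_def; field; exact: lt0r_neq0.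
rewrite ltr_pdivlMr ?ltr_pdivrMr ?exprn_gt0 // ltr_pM2l //.
by apply/andP; split; nra.
Qed.

Lemma orbit_initial_values (x : nat -> rat)
    (x_0 : x 0%N = 1)
    (x_rec : forall n : nat, x n.+1 = 1 + n%:R / x n) :
  [/\ x 1 = 1, x 2 = 2, x 3 = 2 & x 4 = 5 / 2].
Proof. by rewrite !x_rec x_0; split; field. Qed.

Lemma pronic_trapped (x : nat -> rat)
    (x_0 : x 0%N = 1)
    (x_rec : forall n : nat, x n.+1 = 1 + n%:R / x n)
    (n : nat) :
  (4 <= n)%N ->
  1 < x n /\ n%:R - 1 < x n * (x n - 1) < n%:R.
Proof.
move=> /subnK <-; elim: (n - 4)%N => [|m [x_gt1 trap]].
  by have [_ _ _ ->] := orbit_initial_values x x_0 x_rec.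
have k_gt0 : 0 < (m + 4)%:R :> rat by rewrite ltr0n addnS.
have := pronic_trap_step _ _ _ _ k_gt0 x_gt1 trap (x_rec _).
rewrite addSn -natr1 addrK => ?; split=> //.
by rewrite x_rec ltrDl divr_gt0 //; lra.
Qed.

Lemma orbit_not_int (x : nat -> rat)
    (x_0 : x 0%N = 1)
    (x_rec : forall n : nat, x n.+1 = 1 + n%:R / x n)
    (n : nat) :
  (4 <= n)%N -> x n \isn't a Num.int.
Proof.
move=> /(pronic_trapped x x_0 x_rec)[_]; apply: contraL => /intrP[k ->].
have -> : n%:R - 1 = (n%:Z - 1)%:~R :> rat by rewrite intrB.
have -> : n%:R = n%:Z%:~R :> rat by [].
rewrite -[1]/(1%:~R) -intrB -intrM !ltr_int.
by apply/negP; lia.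
Qed.

Theorem mainTheorem1 (x : nat -> rat)
    (x_0 : x 0%N = 1)
    (x_rec : forall n : nat, x n.+1 = 1 + n%:R / x n)
    (n : nat) :
  x n \is a Num.int <-> n \in [:: 0; 1; 2; 3]%N.
Proof.
have [x_1 x_2 x_3 _] := orbit_initial_values x x_0 x_rec.
split; last first.
  by rewrite !inE => /or4P[] /eqP->; rewrite ?x_0 ?x_1 ?x_2 ?x_3.
apply: contraLR => n_notin; apply: orbit_not_int => //.
by move: n_notin; do 4?[case: n => [|n] //].
Qed.
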